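(* Consider the equation $$x_{n+1}=\frac{x_nx_{n-1}+x_{n-1}+1}{x_nx_{n-1}},\qquad n=0,1,\ldots,$$ with initial values $x_{-1},x_0\in(0,+\infty)$, and let $$\alpha=\frac{1+\sqrt[3]{19+3\sqrt{33}}+\sqrt[3]{19-3\sqrt{33}}}{3},$$ so that $\bar x=\alpha$ is the unique equilibrium point of the equation in $(0,+\infty)$. Then the equilibrium point $\bar x=\alpha$ is globally stable.
   Context: The number $\alpha$ is the real root of $\lambda^3-\lambda^2-\lambda-1=0$. An equilibrium point is a value $\bar x$ such that the constant sequence $x_n=\bar x$ solves the equation. The equilibrium $\alpha$ is locally stable if for every $\varepsilon>0$ there is $\delta>0$ such that positive initial values with $|x_{-1}-\alpha|<\delta$, $|x_0-\alpha|<\delta$ yield $|x_n-\alpha|<\varepsilon$ for all $n\ge -1$. It is locally asymptotically stable if it is locally stable and there is $r>0$ such that positive initial values with $|x_{-1}-\alpha|<r$, $|x_0-\alpha|<r$ yield $x_n\to\alpha$. ''Globally stable'' means locally asymptotically stable and $x_n\to\alpha$ for all initial values in $(0,+\infty)$. *)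

(* Defs.v *)
From Stdlib Require Export Reals.
Open Scope R_scope.

(* A sequence (x_n) with n >= -1 is encoded as x : nat -> R shifted by one:
   [x k] stands for x_{k-1}, so [x 0] and [x 1] are the initial values
   x_{-1} and x_0. *)

(* x_{n+1} = f x_n x_{n-1} for every n >= 0. *)
Definition solves (f : R -> R -> R) (x : nat -> R) : Prop :=
  forall n : nat, x (S (S n)) = f (x (S n)) (x n).

Definition positive_initial_values (x : nat -> R) : Prop :=
  0 < x 0%nat /\ 0 < x 1%nat.

Definition equilibrium (f : R -> R -> R) (a : R) : Prop :=
  solves f (fun _ : nat => a).

Definition locally_stable (f : R -> R -> R) (a : R) : Prop :=
  forall eps : R, 0 < eps ->
  exists delta : R, 0 < delta /\
    forall x : nat -> R,
      solves f x -> positive_initial_values x ->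
      Rabs (x 0%nat - a) < delta -> Rabs (x 1%nat - a) < delta ->
      forall n : nat, Rabs (x n - a) < eps.

Definition locally_asymptotically_stable (f : R -> R -> R) (a : R) : Prop :=
  locally_stable f a /\
  exists r : R, 0 < r /\
    forall x : nat -> R,
      solves f x -> positive_initial_values x ->
      Rabs (x 0%nat - a) < r -> Rabs (x 1%nat - a) < r ->
      Un_cv x a.

Definition globally_stable (f : R -> R -> R) (a : R) : Prop :=
  locally_asymptotically_stable f a /\
  forall x : nat -> R,
    solves f x -> positive_initial_values x -> Un_cv x a.

(* Here u = x_n and v = x_{n-1}. Division by zero, which is total here, never
   occurs along a solution with positive initial values. *)
Definition rhs (u v : R) : R := (u * v + v + 1) / (u * v).

(* [Rpower] is the cube root only on positive reals; 19 - 3 sqrt 33 > 0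
   because 19^2 = 361 > 297 = 9 * 33. *)
Definition cbrt (t : R) : R := Rpower t (1 / 3).

Definition alpha : R :=
  (1 + cbrt (19 + 3 * sqrt 33) + cbrt (19 - 3 * sqrt 33)) / 3.

(* Main.v *)
Require Import Defs.
From Stdlib Require Import Reals Lra Lia.
Open Scope R_scope.

(** A positive solution is [x_n = a_n / a_(n-1)] for a sequence with the
    Tribonacci recurrence [a_(n+1) = a_n + a_(n-1) + a_(n-2)], whose
    characteristic polynomial is [(t - alpha) (t^2 + (alpha - 1) t + 1 / alpha)].
    Hence [e_n = a_(n+1) - alpha a_n] satisfies the recurrence of the quadratic
    factor, and the form [e_(n+1)^2 + (alpha - 1) e_(n+1) e_n + e_n^2 / alpha],
    which is positive definite, is multiplied by [1 / alpha] at each step.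
    Divided by [a_n^2], it is a Lyapunov function of [x_n], multiplied by
    [1 / (alpha x_(n+1)^2)] at each step; and [x_n > 1] for [n >= 1]. *)

(** * The cubic equation of [alpha] and numerical bounds *)

Lemma cbrt_pos (t : R) : 0 < cbrt t.
Proof. apply exp_pos. Qed.

Lemma cbrt_cubed (t : R) : 0 < t -> cbrt t ^ 3 = t.
Proof.
  intros Ht. rewrite <- Rpower_pow by apply cbrt_pos.
  unfold cbrt. rewrite Rpower_mult. simpl INR.
  replace (1 / 3 * (1 + 1 + 1)) with 1 by field.
  now apply Rpower_1.
Qed.

Lemma cbrt_mult (s t : R) : 0 < s -> 0 < t -> cbrt (s * t) = cbrt s * cbrt t.
Proof. intros Hs Ht. unfold cbrt. symmetry. now apply Rpower_mult_distr. Qed.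

Lemma cbrt_64 : cbrt 64 = 4.
Proof.
  unfold cbrt. replace 64 with (Rpower 4 3).
  - rewrite Rpower_mult. replace (3 * (1 / 3)) with 1 by field.
    apply Rpower_1; lra.
  - replace 3 with (INR 3) by (simpl; ring).
    rewrite Rpower_pow by lra. ring.
Qed.

(* Cardano: [p = cbrt (19 + 3 sqrt 33)] and [q = cbrt (19 - 3 sqrt 33)] have
   [p^3 + q^3 = 38] and [p q = 4], so [(p + q)^3 = 38 + 12 (p + q)]. *)
Lemma alpha_cubic : alpha ^ 3 = alpha ^ 2 + alpha + 1.
Proof.
  assert (Hs : sqrt 33 * sqrt 33 = 33) by (apply sqrt_sqrt; lra).
  assert (Hs0 : 0 <= sqrt 33) by apply sqrt_pos.
  assert (H19 : 0 < 19 - 3 * sqrt 33) by nra.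
  assert (Hp := cbrt_cubed (19 + 3 * sqrt 33) ltac:(lra)).
  assert (Hq := cbrt_cubed (19 - 3 * sqrt 33) H19).
  assert (Hpq := cbrt_mult (19 + 3 * sqrt 33) (19 - 3 * sqrt 33)
                   ltac:(lra) H19).
  replace ((19 + 3 * sqrt 33) * (19 - 3 * sqrt 33)) with 64 in Hpq
    by (ring_simplify; rewrite <- Rsqr_pow2; unfold Rsqr; lra).
  rewrite cbrt_64 in Hpq.
  unfold alpha.
  set (p := cbrt (19 + 3 * sqrt 33)) in *.
  set (q := cbrt (19 - 3 * sqrt 33)) in *.
  assert (Hc : (p + q) ^ 3 = 38 + 12 * (p + q)).
  { replace ((p + q) ^ 3) with (p ^ 3 + q ^ 3 + 3 * (p * q) * (p + q)) by ring.
    rewrite Hp, Hq, <- Hpq. ring. }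
  replace (((1 + p + q) / 3) ^ 3)
    with ((1 + 3 * (p + q) + 3 * (p + q) ^ 2 + (p + q) ^ 3) / 27) by field.
  rewrite Hc. field.
Qed.

Lemma alpha_pos : 0 < alpha.
Proof.
  unfold alpha.
  assert (H1 := cbrt_pos (19 + 3 * sqrt 33)).
  assert (H2 := cbrt_pos (19 - 3 * sqrt 33)). lra.
Qed.

Lemma alpha_bounds : 9 / 5 < alpha < 19 / 10.
Proof.
  assert (H := alpha_cubic). assert (H0 := alpha_pos).
  assert (Hsq : alpha * (alpha * alpha - alpha - 1) = 1) by lra.
  (* The left side of [Hsq] is 0.792 at 9/5 and 1.349 at 19/10, on either side of 1. *)
  split; apply Rnot_le_lt; intros Hle; nra.
Qed.

(* [1 / alpha], written as a polynomial in [alpha]. *)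
Definition beta : R := alpha ^ 2 - alpha - 1.

Lemma alpha_beta : alpha * beta = 1.
Proof. unfold beta. assert (H := alpha_cubic). lra. Qed.

Lemma beta_bounds : 1 / 2 < beta < 3 / 5.
Proof.
  assert (H := alpha_beta). assert (Ha := alpha_bounds). split; nra.
Qed.

(** * Positive equilibria *)

Lemma equilibrium_rhs_iff (a : R) :
  0 < a -> (equilibrium rhs a <-> a ^ 3 = a ^ 2 + a + 1).
Proof.
  intros Ha. unfold equilibrium, solves, rhs. split.
  - intros H. specialize (H 0%nat).
    apply (f_equal (fun z => z * (a * a))) in H.
    field_simplify in H; lra.
  - intros H _. apply (Rmult_eq_reg_r (a * a)); [|nra].
    field_simplify; lra.
Qed.

(** The cubic is [a - alpha] times a quadratic whose coefficients are all positive, so the quadratic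
    has no positive root. *)
Lemma cubic_root_unique (a : R) :
  0 < a -> a ^ 3 = a ^ 2 + a + 1 -> a = alpha.
Proof.
  intros Ha H.
  assert (Hal := alpha_cubic). assert (Hb := alpha_bounds).
  assert (Hbeta := beta_bounds).
  assert (Hf : (a - alpha) * (a ^ 2 + (alpha - 1) * a + beta) = 0).
  { unfold beta. ring_simplify. lra. }
  apply Rmult_integral in Hf. destruct Hf as [Hf|Hf]; [lra|nra].
Qed.

(** * Positive solutions and their Lyapunov function *)

Lemma solution_pos (x : nat -> R) :
  solves rhs x -> positive_initial_values x -> forall n, 0 < x n.
Proof.
  intros Hx [H0 H1] n.
  enough (0 < x n /\ 0 < x (S n)) by tauto.
  induction n as [|n [IH0 IH1]]; [tauto|].
  split; [assumption|]. rewrite Hx. unfold rhs.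
  assert (0 < x (S n) * x n) by (apply Rmult_lt_0_compat; assumption).
  apply Rdiv_lt_0_compat; lra.
Qed.

Lemma solution_step (x : nat -> R) :
  solves rhs x -> positive_initial_values x ->
  forall n, x (S (S n)) * (x (S n) * x n) = x (S n) * x n + x n + 1.
Proof.
  intros Hx Hp n.
  assert (H0 := solution_pos x Hx Hp n).
  assert (H1 := solution_pos x Hx Hp (S n)).
  rewrite Hx. unfold rhs. field. lra.
Qed.

(** The right-hand side equals [1 + (v + 1) / (u * v)]. *)
Lemma solution_gt_1 (x : nat -> R) :
  solves rhs x -> positive_initial_values x -> forall n, 1 < x (S (S n)).
Proof.
  intros Hx Hp n.
  assert (H0 := solution_pos x Hx Hp n).
  assert (H1 := solution_pos x Hx Hp (S n)).
  assert (H := solution_step x Hx Hp n).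
  assert (0 < x (S n) * x n) by (apply Rmult_lt_0_compat; assumption).
  nra.
Qed.

(** Reading [x n] as [a_n / a_(n-1)], the two arguments of the quadratic form are [e_n] and
    [e_(n-1)], both divided by [a_(n-1)]. *)
Definition lyapunov (x : nat -> R) (n : nat) : R :=
  (x n * (x (S n) - alpha)) ^ 2
  + (alpha - 1) * (x n * (x (S n) - alpha)) * (x n - alpha)
  + beta * (x n - alpha) ^ 2.

(* Positive definiteness: [1 / alpha - (alpha - 1)^2 / 4 > 1 / 4]. *)
Lemma lyapunov_ge (x : nat -> R) (n : nat) :
  (x n - alpha) ^ 2 <= 4 * lyapunov x n.
Proof.
  unfold lyapunov.
  set (e := x n * (x (S n) - alpha)). set (d := x n - alpha).
  assert (Ha := alpha_bounds). assert (Hb := beta_bounds).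
  replace (4 * (e ^ 2 + (alpha - 1) * e * d + beta * d ^ 2))
    with ((2 * e + (alpha - 1) * d) ^ 2
          + (4 * beta - (alpha - 1) ^ 2) * d ^ 2) by ring.
  assert (1 <= 4 * beta - (alpha - 1) ^ 2) by nra.
  assert (0 <= (2 * e + (alpha - 1) * d) ^ 2) by apply pow2_ge_0.
  assert (0 <= d ^ 2) by apply pow2_ge_0.
  nra.
Qed.

Lemma lyapunov_nonneg (x : nat -> R) (n : nat) : 0 <= lyapunov x n.
Proof.
  assert (H := lyapunov_ge x n).
  assert (0 <= (x n - alpha) ^ 2) by apply pow2_ge_0. lra.
Qed.

Lemma lyapunov_step (x : nat -> R) :
  solves rhs x -> positive_initial_values x ->
  forall n, x n ^ 2 * lyapunov x (S n) = beta * lyapunov x n.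
Proof.
  intros Hx Hp n.
  assert (H := solution_step x Hx Hp n).
  unfold lyapunov.
  set (e := x n * (x (S n) - alpha)). set (d := x n - alpha).
  (* The recurrence [e_(n+1) = - (alpha - 1) e_n - e_(n-1) / alpha], divided by [a_(n-1)]. *)
  assert (He : x n * (x (S n) * (x (S (S n)) - alpha))
               = - (alpha - 1) * e - beta * d).
  { replace (x n * (x (S n) * (x (S (S n)) - alpha)))
      with (x (S (S n)) * (x (S n) * x n) - alpha * x (S n) * x n) by ring.
    rewrite H. unfold e, d.
    assert (Hab := alpha_beta). unfold beta in *. ring_simplify. lra. }
  set (e2 := x (S n) * (x (S (S n)) - alpha)) in *.
  replace (x n ^ 2 * _)
    with ((x n * e2) ^ 2 + (alpha - 1) * (x n * e2) * e + beta * e ^ 2)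
    by (unfold e; ring).
  rewrite He. ring.
Qed.

Lemma lyapunov_contract (x : nat -> R) :
  solves rhs x -> positive_initial_values x ->
  forall n, 1 <= x n -> lyapunov x (S n) <= beta * lyapunov x n.
Proof.
  intros Hx Hp n Hn.
  rewrite <- (lyapunov_step x Hx Hp n).
  assert (H := lyapunov_nonneg x (S n)).
  assert (1 <= x n ^ 2) by nra. nra.
Qed.

(** The decay is counted from index 2 because the two initial values may be below 1, where the
    Lyapunov function can grow. *)
Lemma lyapunov_geometric (x : nat -> R) :
  solves rhs x -> positive_initial_values x ->
  forall n, lyapunov x (S (S n)) <= beta ^ n * lyapunov x 2.
Proof.
  intros Hx Hp n. assert (Hb := beta_bounds).
  induction n as [|n IH]; [simpl; lra|].
  apply Rle_trans with (beta * lyapunov x (S (S n))).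
  - apply lyapunov_contract; try assumption.
    apply Rlt_le, solution_gt_1; assumption.
  - simpl. rewrite Rmult_assoc. apply Rmult_le_compat_l; lra.
Qed.

(** * Global convergence *)

Lemma solution_cv (x : nat -> R) :
  solves rhs x -> positive_initial_values x -> Un_cv x alpha.
Proof.
  intros Hx Hp eps Heps.
  assert (Hb := beta_bounds).
  assert (HV := lyapunov_nonneg x 2).
  (* The factor 4 comes from [lyapunov_ge]; adding 1 keeps the denominator positive when
     [lyapunov x 2] is 0. *)
  assert (Heta : 0 < eps ^ 2 / (4 * (lyapunov x 2 + 1))).
  { apply Rdiv_lt_0_compat; [apply pow_lt|]; lra. }
  destruct (pow_lt_1_zero beta ltac:(rewrite Rabs_pos_eq; lra) _ Heta)
    as [N HN].
  exists (S (S N)). intros [|[|n]] Hn; [lia|lia|].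
  specialize (HN n ltac:(lia)).
  assert (Hbn : 0 < beta ^ n) by (apply pow_lt; lra).
  rewrite Rabs_pos_eq in HN by lra.
  apply (Rmult_lt_compat_r (4 * (lyapunov x 2 + 1))) in HN; [|lra].
  replace (eps ^ 2 / (4 * (lyapunov x 2 + 1)) * (4 * (lyapunov x 2 + 1)))
    with (eps ^ 2) in HN by (field; lra).
  assert (Hg := lyapunov_geometric x Hx Hp n).
  assert (Hd := lyapunov_ge x (S (S n))).
  unfold Rdist. rewrite <- (Rabs_pos_eq eps) by lra.
  apply Rsqr_lt_abs_0. rewrite !Rsqr_pow2. lra.
Qed.

(** * Local stability *)

Lemma lyapunov_0_le (x : nat -> R) (delta : R) :
  delta <= 1 / 4 ->
  Rabs (x 0%nat - alpha) < delta -> Rabs (x 1%nat - alpha) < delta ->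
  lyapunov x 0 <= 9 * delta ^ 2.
Proof.
  intros Hd H0 H1. apply Rabs_def2 in H0. apply Rabs_def2 in H1.
  unfold lyapunov.
  assert (Ha := alpha_bounds). assert (Hb := beta_bounds).
  set (y := x 0%nat) in *. set (d0 := y - alpha) in *.
  set (d1 := x 1%nat - alpha) in *.
  (* Here 43/20 is 19/10 + 1/4. The three terms of the form are then at most 5, 2 and 1 times
     [delta ^ 2]. *)
  assert (Hy : 0 <= y <= 43 / 20) by (unfold d0 in H0; lra).
  assert (Hd0 : d0 ^ 2 <= delta ^ 2) by nra.
  assert (Hd1 : d1 ^ 2 <= delta ^ 2) by nra.
  assert (Hsq : 0 <= d0 ^ 2) by apply pow2_ge_0.
  assert (Hsq1 : 0 <= d1 ^ 2) by apply pow2_ge_0.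
  assert (Hp : d1 * d0 <= delta ^ 2) by nra.
  assert (Hy2 : 0 <= y ^ 2 <= 5) by nra.
  assert (Hc : 0 <= (alpha - 1) * y <= 2) by nra.
  replace ((y * d1) ^ 2 + (alpha - 1) * (y * d1) * d0 + beta * d0 ^ 2)
    with (y ^ 2 * d1 ^ 2 + (alpha - 1) * y * (d1 * d0) + beta * d0 ^ 2)
    by ring.
  assert (y ^ 2 * d1 ^ 2 <= 5 * delta ^ 2) by nra.
  assert ((alpha - 1) * y * (d1 * d0) <= 2 * delta ^ 2) by nra.
  assert (beta * d0 ^ 2 <= delta ^ 2) by nra.
  lra.
Qed.

Lemma alpha_locally_stable : locally_stable rhs alpha.
Proof.
  (* The bound 1/4 keeps both initial values above 1, so the Lyapunov function decreases from index
     0 on; [eps / 7] works because 4 * 9 = 36 < 49. *)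
  intros eps Heps. exists (Rmin (1 / 4) (eps / 7)).
  assert (Hm1 := Rmin_l (1 / 4) (eps / 7)).
  assert (Hm2 := Rmin_r (1 / 4) (eps / 7)).
  assert (Hm : 0 < Rmin (1 / 4) (eps / 7)) by (apply Rmin_glb_lt; lra).
  set (delta := Rmin (1 / 4) (eps / 7)) in *.
  split; [assumption|].
  intros x Hx Hp H0 H1 n.
  assert (Ha := alpha_bounds). assert (Hb := beta_bounds).
  assert (Hge1 : forall k, 1 <= x k).
  { intros [|[|k]].
    - apply Rabs_def2 in H0. lra.
    - apply Rabs_def2 in H1. lra.
    - apply Rlt_le, solution_gt_1; assumption. }
  assert (Hdecr : lyapunov x n <= lyapunov x 0).
  { induction n as [|n IH]; [lra|].
    assert (Hc := lyapunov_contract x Hx Hp n (Hge1 n)).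
    assert (Hn := lyapunov_nonneg x n). nra. }
  assert (HV := lyapunov_0_le x delta Hm1 H0 H1).
  assert (Hd := lyapunov_ge x n).
  rewrite <- (Rabs_pos_eq eps) by lra.
  apply Rsqr_lt_abs_0. rewrite !Rsqr_pow2.
  assert (49 * delta ^ 2 <= eps ^ 2) by nra.
  assert (0 < delta ^ 2) by (apply pow_lt; assumption).
  lra.
Qed.

Theorem theorem5 :
  unique (fun a : R => 0 < a /\ equilibrium rhs a) alpha /\
  globally_stable rhs alpha.
Proof.
  split; [split|split; [split|]].
  - split; [apply alpha_pos|].
    apply equilibrium_rhs_iff; [apply alpha_pos|apply alpha_cubic].
  - intros a [Ha He]. symmetry.
    apply cubic_root_unique; [assumption|].
    now apply equilibrium_rhs_iff.
  - apply alpha_locally_stable.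
  - exists 1. split; [lra|]. intros x Hx Hp _ _. now apply solution_cv.
  - apply solution_cv.
Qed.
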